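(* Let $m,n\ge 1$, let $I\subset\{1,\ldots,m\}$ and $J\subset\{1,\ldots,n\}$ be subsets with the same number $r\geq 1$ of elements, and let $\Delta_{I,J}$ be the corresponding minor, regarded as a regular function on the matrix affine Poisson space $(M_{m,n},\pi_{m,n})$. Then the Hamiltonian flow of $\Delta_{I,J}$ is complete over $\mathbb{C}$, i.e. for every initial condition $X(0)\in M_{m,n}$ the integral curve $X(t)=(x_{kl}(t))$ of the Hamiltonian vector field of $\Delta_{I,J}$ through $X(0)$ is defined for all $t\in\mathbb{C}$. In addition, each matrix entry evolves quasi-exponentially according to this flow: $$x_{kl}(t)=p(t)+\sum_{a=1}^N p_a(t)e^{\alpha_a t},\qquad t\in\mathbb{C},$$ for some polynomials $p(t),p_1(t),\ldots,p_N(t)$ such that $\deg p(t)\le 2r-1$ and $\deg p_a(t)\le 2r-2$ for $a=1,\ldots,N$, and some $\alpha_1,\ldots,\alpha_N\in\mathbb{C}^*$. (The integer $N$, the polynomials $p(t),p_a(t)$ and the exponents $\alpha_a$ depend on the initial condition.)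
   Context: $M_{m,n}$ is the complex affine space of $m\times n$ complex matrices with coordinate functions $x_{ij}$, equipped with the quadratic Poisson structure $$\pi_{m,n}=\sum_{i,k=1}^m\sum_{j,l=1}^n(\mathrm{sign}(k-i)+\mathrm{sign}(l-j))\,x_{il}x_{kj}\,\frac{\partial}{\partial x_{ij}}\wedge\frac{\partial}{\partial x_{kl}},$$ where $\mathrm{sign}(a)=1,0,-1$ according to $a>0$, $a=0$, $a<0$. The normalization of the bracket is $\{x_{ij},x_{kl}\}=(\mathrm{sign}(k-i)+\mathrm{sign}(l-j))\,x_{il}x_{kj}$. For $I\subset\{1,\ldots,m\}$, $J\subset\{1,\ldots,n\}$ with $|I|=|J|$, $\Delta_{I,J}(X)$ is the determinant of the submatrix of $X$ with rows $I$ and columns $J$. Integral curves of a Hamiltonian $H$ are (holomorphic, complex time) solutions of $x_{kl}'(t)=\{x_{kl},H\}(X(t))$ for all $k,l$. *)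

(* Defs.v *)
From HB Require Import structures.
From mathcomp Require Import all_boot all_order all_algebra.
From mathcomp Require Import all_classical all_reals all_analysis.
From mathcomp Require Import complex.

Set Implicit Arguments.
Unset Strict Implicit.
Unset Printing Implicit Defensive.

Import Order.TTheory GRing.Theory Num.Theory.
Import numFieldNormedType.Exports.

Local Open Scope ring_scope.
Local Open Scope complex_scope.

(* The usual topology on R[i], given by the modulus `|z|; the scalars are R[i],
   so that [derive], [derivable] and [is_derive] below are complex (holomorphic)
   notions. *)
HB.instance Definition _ (R : rcfType) :=
  NormedModule.copy R[i] (R[i] : numFieldType)^o.

(* exp (x + i y) = exp x * (cos y + i sin y) *)
Definition cexp (R : realType) (z : R[i]) : R[i] :=
  (expR (complex.Re z) * cos (complex.Im z))
    +i* (expR (complex.Re z) * sin (complex.Im z)).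

Section MatrixPoisson.
Variables (R : realType) (m n : nat).
Implicit Types (f g H : 'M[R[i]]_(m, n) -> R[i]) (X : 'M[R[i]]_(m, n)).

Definition mxcoord (i : 'I_m) (j : 'I_n) : 'M[R[i]]_(m, n) -> R[i] :=
  fun X => X i j.

Definition mxpartial (i : 'I_m) (j : 'I_n) f X : R[i] :=
  'D_(delta_mx i j) f X.

Definition pi_coef (i k : 'I_m) (j l : 'I_n) X : R[i] :=
  (Num.sg (k%:Z - i%:Z) + Num.sg (l%:Z - j%:Z))%:~R * X i l * X k j.

(* pi applied to (df, dg); as the sum runs over ordered pairs, each wedge is
   counted so that {x_ij, x_kl} = (sign (k - i) + sign (l - j)) x_il x_kj,
   with no extra factor 2. *)
Definition poisson_bracket f g X : R[i] :=
  \sum_(i < m) \sum_(k < m) \sum_(j < n) \sum_(l < n)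
    pi_coef i k j l X * mxpartial i j f X * mxpartial k l g X.

(* [enum_val] lists the elements of a set of ordinals in increasing order. *)
Definition minor (r : nat) (I : {set 'I_m}) (J : {set 'I_n})
    (cardI : #|I| = r) (cardJ : #|J| = r) X : R[i] :=
  \det (\matrix_(a < r, b < r)
          X (enum_val (cast_ord (esym cardI) a))
            (enum_val (cast_ord (esym cardJ) b))).

Definition integral_curve H (X : R[i] -> 'M[R[i]]_(m, n)) : Prop :=
  forall (t : R[i]) (k : 'I_m) (l : 'I_n),
    is_derive t 1 (fun s => X s k l) (poisson_bracket (mxcoord k l) H (X t)).

Definition complete_flow H : Prop :=
  forall X0 : 'M[R[i]]_(m, n),
    exists X : R[i] -> 'M[R[i]]_(m, n), X 0 = X0 /\ integral_curve H X.

End MatrixPoisson.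

(* Main.v *)
Require Import Defs.
From HB Require Import structures.
From mathcomp Require Import all_boot all_order all_algebra.
From mathcomp Require Import all_classical all_reals all_analysis.
From mathcomp Require Import complex.
From mathcomp Require Import ring lra zify.

Set Implicit Arguments.
Unset Strict Implicit.
Unset Printing Implicit Defensive.

Import Order.TTheory GRing.Theory Num.Theory.
Import numFieldNormedType.Exports.

Local Open Scope ring_scope.

(* Write A for the submatrix of X with rows I and columns J, d = det A, V for the
   part of column l in the rows I and W for the part of row k in the columns J.
   Then x_kl' = W (adj A E + D adj A) V, where E and D are the diagonal sign
   matrices of I relative to k and of J relative to l.  Hence A and d are
   constant along the flow.  For l outside J, V solves V' = M V with
   M = A D adj A, and D^2 = 1 gives M^2 = d^2, so that
   V = cosh(dt) V_0 + (sinh(dt)/d) M V_0; rows k outside I are symmetric.  When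
   both k and l are outside, with c = cosh(dt), s = sinh(dt)/d and v the initial
   velocity, the velocity becomes (c^2 + d^2 s^2) v + 2 c s b, which integrates
   to x_kl = x_kl(0) + c s v + s^2 b.  For d <> 0 only constants and the
   exponentials of +-dt, +-2dt occur; for d = 0 we get c = 1 and s = t, hence a
   polynomial of degree at most 2, and if moreover r = 1 then A = 0, so b = 0. *)

(** * Complex derivatives and the exponential *)

Lemma is_derive_cvgP (K : numFieldType) (V W : normedModType K)
    (f : V -> W) (a v : V) (df : W) :
  is_derive a v f df <->
  (h^-1 *: (f (h *: v + a) - f a) @[h --> 0^'] --> df)%classic.
Proof.
split=> [[fav <-] //|h]; apply: DeriveDef; first by apply/cvg_ex; exists df.
exact: cvg_lim.
Qed.

(** Multiplying the difference quotient out by [h] removes the case [h = 0] and leaves plain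
    estimates, usable over both [R] and [R[i]]. *)
Lemma is_derive1P (K : numFieldType) (f : K^o -> K^o) (a df : K) :
  is_derive (a : K^o) (1 : K^o) f df <->
  forall e : K, 0 < e -> exists2 d : K, 0 < d &
    forall h, `|h| < d -> `|f (a + h) - f a - h * df| <= e * `|h|.
Proof.
rewrite is_derive_cvgP; split=> [/cvgrPdist_le fP e e0|fP].
  have := fP e e0; rewrite near_withinE => /nbhs_norm0P[d /= d0 dP].
  exists d => // h hd; have [->|h0] := eqVneq h 0.
    by rewrite addr0 subrr mul0r subr0 normr0 mulr0.
  have := dP h hd h0; rewrite [_%:A]mulr1 [_ *: _]mulrC => ub.
  have -> : f (a + h) - f a - h * df = h * - (df - (f (h + a) - f a) / h).
    by rewrite (addrC h); field.
  by rewrite normrM normrN mulrC ler_wpM2r.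
apply/cvgrPdist_le => e e0; have [d d0 dP] := fP e e0.
rewrite near_withinE; apply/(@nbhs_norm0P _ K^o); exists d => //= h hd h0.
rewrite [_%:A]mulr1 [_ *: _]mulrC.
have -> : df - (f (h + a) - f a) / h = - (f (a + h) - f a - h * df) / h.
  by rewrite (addrC h); field.
by rewrite normrM normrN normfV ler_pdivrMr ?normr_gt0 //; exact: dP.
Qed.

Section Complex.
Variable R : realType.
Implicit Types (f : R[i] -> R[i]) (z : R[i]).

Lemma normc_ge_Im z : `|complex.Im z|%:C%C <= `|z|.
Proof.
rewrite normc_def lecR -[X in X <= _]ger0_norm // -sqrtr_sqr.
by rewrite ler_wsqrtr // real_normK ?num_real // lerDr sqr_ge0.
Qed.

Lemma normc_le_ReIm z : `|z| <= (`|complex.Re z| + `|complex.Im z|)%:C%C.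
Proof.
rewrite normc_def lecR; set x := complex.Re z; set y := complex.Im z.
rewrite -[leRHS]ger0_norm ?addr_ge0 // -sqrtr_sqr ler_wsqrtr //.
rewrite sqrrD !real_normK ?num_real // addrAC lerDl.
by rewrite mulrn_wge0 // mulr_ge0.
Qed.

Lemma complex_gt0E z : 0 < z -> exists2 d : R, 0 < d & z = d%:C%C.
Proof.
by case: z => d b; rewrite ltcE /= => /andP[/eqP -> d0]; exists d.
Qed.

(** Along the segment from 0 to [z], [P] of [f] is a real function of one real variable with zero
    derivative, so the real constancy theorem applies. [P] stands for the real or the imaginary
    part. *)
Lemma is_derive0_real_cst (P : R[i] -> R) f :
    (forall z w, P (z - w) = P z - P w) -> (forall z, `|P z|%:C%C <= `|z|) ->
  (forall z, is_derive z 1 f 0) -> forall z, P (f z) = P (f 0).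
Proof.
move=> PB Ple f0 z; pose g (s : R) := P (f (s%:C%C * z)).
suff g0 (s : R) : is_derive (s : R^o) (1 : R^o) (g : R^o -> R^o) 0.
  by have := is_derive_0_is_cst 1 0 g0; rewrite /g mul1r mul0r.
apply/is_derive1P => e e0.
(* [1 + |z|] serves as the Lipschitz constant of [s |-> s z], so that dividing by it is safe at
   [z = 0]. *)
have nz : 0 < 1 + `|z| by rewrite ltr_pwDl.
have e'0 : 0 < e%:C%C / (1 + `|z|) by rewrite divr_gt0 // ltcR.
have /is_derive1P/(_ _ e'0)[d d0 dP] := f0 (s%:C%C * z).
have [d' d'0 dd'] : exists2 d' : R, 0 < d' & d / (1 + `|z|) = d'%:C%C.
  by apply: complex_gt0E; rewrite divr_gt0.
exists d' => // h hd'; rewrite mulr0 subr0 /g -PB.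
rewrite -lecR (le_trans (Ple _)) // !rmorphD /= mulrDl.
have nh : `|h%:C%C| = `|h|%:C%C :> R[i].
  by rewrite normc_def /= expr0n addr0 sqrtr_sqr.
have hz : `|h%:C%C * z| <= `|h|%:C%C * (1 + `|z|).
  by rewrite normrM nh ler_wpM2l ?lerDr // lecR.
have hzd : `|h%:C%C * z| < d.
  apply: le_lt_trans hz _; by rewrite -ltr_pdivlMr // dd' ltcR.
have := dP _ hzd; rewrite mulr0 subr0 => /le_trans; apply.
apply: le_trans (ler_wpM2l (ltW e'0) hz) _.
by rewrite mulrCA -mulrA mulVf ?gt_eqF // mulr1 mulrC rmorphM.
Qed.

Lemma is_derive0_cst f :
  (forall z, is_derive z 1 f 0) -> forall z, f z = f 0.
Proof.
move=> f0 z; apply/eqP; rewrite eq_complex.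
rewrite (is_derive0_real_cst (P := @complex.Re R)) ?eqxx //=.
- rewrite (is_derive0_real_cst (P := @complex.Im R)) //.
    by move=> [? ?] [? ?].
  exact: normc_ge_Im.
- by move=> [? ?] [? ?].
- exact: normc_ge_Re.
Qed.

Lemma cexp0 : cexp 0 = 1 :> R[i].
Proof. by rewrite /cexp /= expR0 cos0 sin0 mulr1 mulr0. Qed.

Lemma cexpD z w : cexp (z + w) = cexp z * cexp w.
Proof.
case: z w => [a b] [a' b']; rewrite /cexp /= expRD cosD sinD.
by apply/eqP; rewrite eq_complex /=; apply/andP; split; apply/eqP; ring.
Qed.

(** The real and imaginary parts of [cexp h - 1 - h] are combinations of the first-order remainders
    of [expR], [cos] and [sin] at 0. *)
Lemma is_derive_cexp0 : is_derive (0 : R[i]) 1 (@cexp R) 1.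
Proof.
apply/is_derive1P => e /complex_gt0E[e0 e0_gt0 ->{e}].
wlog e0_le1 : e0 e0_gt0 / e0 <= 1.
  move=> wh; have [|/ltW e1] := leP e0 1; first exact: wh.
  have [d d0 dP] := wh 1 ltr01 (lexx 1); exists d => // h /dP /le_trans; apply.
  by rewrite ler_wpM2r // lecR.
(* The two parts add up to at most [e |x| + 6 e |y|], hence to at most [8 e N = e0 N]; [e <= 1/8] is
   what bounds [expR x] by 2. *)
pose e := e0 / 8; have e_gt0 : 0 < e by rewrite divr_gt0.
have [d1 d1_gt0 expP] := (is_derive1P _ _ _).1 (is_derive_expR (0 : R)) e e_gt0.
have [d2 d2_gt0 cosP] := (is_derive1P _ _ _).1 (is_derive_cos (0 : R)) e e_gt0.
have [d3 d3_gt0 sinP] := (is_derive1P _ _ _).1 (is_derive_sin (0 : R)) e e_gt0.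
pose d := Num.min (Num.min d1 d2) (Num.min d3 e).
exists d%:C%C; first by rewrite ltcR !lt_min d1_gt0 d2_gt0 d3_gt0 e_gt0.
case=> x y hd; set h := (x +i* y)%C in hd *.
have : `|x| < d by rewrite -ltcR (le_lt_trans (normc_ge_Re h)).
have : `|y| < d by rewrite -ltcR (le_lt_trans (normc_ge_Im h)).
rewrite !lt_min => /andP[/andP[_ yd2] /andP[yd3 _]].
move=> /andP[/andP[xd1 _] /andP[_ xe]].
have := sinP y yd3; have := cosP y yd2; have := expP x xd1.
rewrite expR0 sin0 cos0 !add0r oppr0 mulr0 !mulr1 !subr0.
move=> xP cP sP.
pose N := complex.Re `|h|; have hN : `|h| = N%:C%C by rewrite normc_def.
have xN : `|x| <= N by rewrite -lecR -hN (normc_ge_Re h).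
have yN : `|y| <= N by rewrite -lecR -hN (normc_ge_Im h).
have x_ge0 := normr_ge0 x; have y_ge0 := normr_ge0 y.
have e_le : e <= 1 / 8 by rewrite /e ler_pM2r.
have exN : e * `|x| <= `|x| / 8 by rewrite mulrC ler_wpM2l // -[leRHS]mul1r.
have E1 : `|expR x - 1| <= 2 * `|x|.
  have -> : expR x - 1 = (expR x - 1 - x) + x by ring.
  by apply: le_trans (ler_normD _ _) _; lra.
have E2 : `|expR x| <= 2.
  have -> : expR x = (expR x - 1) + 1 by ring.
  by apply: le_trans (ler_normD _ _) _; rewrite normr1; lra.
have reP : `|(expR x - 1 - x) + expR x * (cos y - 1)|
    <= e * `|x| + 2 * (e * `|y|).
  apply: le_trans (ler_normD _ _) _; rewrite lerD // normrM.
  by rewrite ler_pM.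
have imP : `|expR x * (sin y - y) + (expR x - 1) * y|
    <= 2 * (e * `|y|) + 2 * e * `|y|.
  apply: le_trans (ler_normD _ _) _; rewrite !normrM lerD //.
    by rewrite ler_pM // -[sin y]addr0.
  by rewrite ler_wpM2r // (le_trans E1) // ler_pM2l // ltW.
rewrite cexp0.
have -> : cexp h - 1 - h = (((expR x - 1 - x) + expR x * (cos y - 1))
    +i* (expR x * (sin y - y) + (expR x - 1) * y))%C.
  by apply/eqP; rewrite eq_complex /=; apply/andP; split; apply/eqP; ring.
apply: le_trans (normc_le_ReIm _) _ => /=.
rewrite hN -rmorphM lecR (le_trans (lerD reP imP)) //.
have -> : e0 = 8 * e by rewrite /e; field.
have : e * `|x| <= e * N by rewrite ler_pM2l.
have : e * `|y| <= e * N by rewrite ler_pM2l.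
have : 0 <= e * N by rewrite mulr_ge0 ?(ltW e_gt0) // (le_trans x_ge0).
by lra.
Qed.

Lemma is_derive_cexp (a z : R[i]) :
  is_derive z 1 (fun t => cexp (a * t)) (a * cexp (a * z)).
Proof.
apply/is_derive1P => e e0.
have na : 0 < 1 + `|a| by rewrite ltr_pwDl.
have nc : 0 < 1 + `|cexp (a * z)| by rewrite ltr_pwDl.
have e'0 : 0 < e / ((1 + `|a|) * (1 + `|cexp (a * z)|)).
  by rewrite divr_gt0 // mulr_gt0.
have [d d0 dP] := (is_derive1P _ _ _).1 is_derive_cexp0 _ e'0.
exists (d / (1 + `|a|)); first by rewrite divr_gt0.
move=> h; rewrite ltr_pdivlMr // => hd.
have ahd : `|a * h| <= (1 + `|a|) * `|h| by rewrite normrM ler_wpM2r // lerDr.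
rewrite mulrDr cexpD.
have -> : cexp (a * z) * cexp (a * h) - cexp (a * z) - h * (a * cexp (a * z))
   = cexp (a * z) * (cexp (0 + a * h) - cexp 0 - a * h * 1).
  by rewrite cexp0 add0r; ring.
rewrite normrM.
have ub : `|cexp (0 + a * h) - cexp 0 - a * h * 1| <=
    e / ((1 + `|a|) * (1 + `|cexp (a * z)|)) * ((1 + `|a|) * `|h|).
  apply: le_trans (dP _ _) _; last by rewrite ler_pM2l.
  by apply: le_lt_trans ahd _; rewrite mulrC.
have le1 : `|cexp (a * z)| <= 1 + `|cexp (a * z)| by rewrite lerDr.
apply: le_trans (ler_pM (normr_ge0 _) (normr_ge0 _) le1 ub) _.
rewrite le_eqVlt; apply/orP; left; apply/eqP.
by field; rewrite !gt_eqF.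
Qed.

End Complex.

(** * The Hamiltonian vector field of a minor *)

(** Coordinates and minors are affine in each single entry, so their difference quotients are
    constant and no differentiation of determinants is required. *)
Lemma derive_affine_along (K : numFieldType) (V : normedModType K)
    (f : V -> K^o) (v a : V) (c : K) :
  (forall h, f (h *: v + a) = f a + h * c) -> 'D_v f a = c.
Proof.
move=> fE; suff [//] : is_derive a v f (c : K^o).
apply/is_derive_cvgP; apply/cvgrPdist_le => e e0.
rewrite near_withinE; apply: nearW => h h0.
by rewrite fE [f a + _]addrC addrK [_ *: _]mulrA mulVf // mul1r subrr normr0 ltW.
Qed.

(** Expand along row [a]: the cofactors of that row do not see its entries, and only the entry in
    column [b] changes. *)
Lemma det_add_delta (K : comNzRingType) (r : nat) (A : 'M[K]_r) a b (h : K) :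
  \det (h *: delta_mx a b + A) = \det A + h * cofactor A a b.
Proof.
have cofE j : cofactor (h *: delta_mx a b + A) a j = cofactor A a j.
  rewrite /cofactor; congr (_ * \det _); apply/matrixP => x y; rewrite !mxE.
  by rewrite eq_sym (negbTE (neq_lift _ _)) mulr0 add0r.
rewrite (expand_det_row _ a) (expand_det_row A a) [in RHS]addrC (bigD1 b) //=.
rewrite [in RHS](bigD1 b) //= !cofE !mxE !eqxx mulr1 mulrDl -!addrA.
congr (_ + (_ + _)); apply: eq_bigr => j /negbTE jb.
by rewrite cofE !mxE eqxx jb mulr0 add0r.
Qed.

Lemma sum_codom (K : nmodType) (I J : finType) (f : I -> J) (F : J -> K) :
    injective f -> (forall j, j \notin codom f -> F j = 0) ->
  \sum_j F j = \sum_i F (f i).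
Proof.
move=> f_inj F0; rewrite [RHS](partition_big f xpredT) //=.
apply: eq_bigr => j _; have [/codomP[i ->]|/[dup] jf /F0 ->] := boolP (j \in codom f).
  by rewrite (big_pred1 i) // => i'; rewrite inj_eq.
by rewrite big_pred0 // => i; apply: contraNF jf => /eqP <-; exact: codom_f.
Qed.

Section Bracket.
Variables (R : realType) (m n r : nat) (f : 'I_r -> 'I_m) (g : 'I_r -> 'I_n).
Hypotheses (f_inj : injective f) (g_inj : injective g).
Implicit Types (X : 'M[R[i]]_(m, n)) (k : 'I_m) (l : 'I_n).

(** The sets I and J enter only through injections [f] and [g] enumerating them. *)
Let subdet X := \det (mxsub f g X).

(** This is E for [h = f] and D for [h = g]. *)
Definition sgn_diag p (h : 'I_r -> 'I_p) (k : 'I_p) : 'M[R[i]]_r :=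
  diag_mx (\row_a (Num.sg ((h a)%:Z - k%:Z))%:~R).

Definition subrow k X : 'rV[R[i]]_r := row k (colsub g X).
Definition subcol l X : 'cV[R[i]]_r := col l (rowsub f X).

Lemma partial_subdet a b X :
  mxpartial (f a) (g b) subdet X = cofactor (mxsub f g X) a b.
Proof.
apply: derive_affine_along => h; rewrite /subdet -det_add_delta.
by congr (\det _); apply/matrixP => x y; rewrite !mxE !inj_eq.
Qed.

Lemma partial_subdet0 k l X :
  (k \notin codom f) || (l \notin codom g) -> mxpartial k l subdet X = 0.
Proof.
move=> kl; apply: derive_affine_along => h; rewrite mulr0 addr0 /subdet.
congr (\det _); apply/matrixP => x y; rewrite !mxE.
case: eqP kl => [<-|_ _]; last by rewrite mulr0 add0r.
case: eqP => [<-|_ _]; last by rewrite mulr0 add0r.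
by rewrite !codom_f.
Qed.

Lemma partial_mxcoord i j k l X :
  mxpartial i j (mxcoord k l) X = ((k == i) && (l == j))%:R.
Proof.
apply: derive_affine_along => h.
by rewrite /mxcoord !mxE addrC.
Qed.

(** The partial derivative at [(f a, g b)] is entry [(b, a)] of the adjugate. The sign of the row
    index [a] therefore multiplies it on the right, and that of the column index [b] on the left. *)
Lemma bracket_subdet k l X :
  poisson_bracket (mxcoord k l) subdet X =
  (subrow k X *m (\adj (mxsub f g X) *m sgn_diag f k
     + sgn_diag g l *m \adj (mxsub f g X)) *m subcol l X) 0 0.
Proof.
rewrite /poisson_bracket (bigD1 k) //= [X in _ + X]big1 ?addr0; last first.
  move=> i /negbTE ik; do 3![rewrite big1 // => ? _].
  by rewrite partial_mxcoord eq_sym ik mulr0 mul0r.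
under eq_bigr => i _.
  rewrite (bigD1 l) //= [X in _ + X]big1 ?addr0; last first.
    move=> j /negbTE jl; rewrite big1 // => ? _.
    by rewrite partial_mxcoord [l == j]eq_sym jl andbF mulr0 mul0r.
  under eq_bigr do rewrite partial_mxcoord !eqxx mulr1.
  over.
rewrite (sum_codom f_inj) => [|i fi]; last first.
  by rewrite big1 // => j _; rewrite partial_subdet0 ?fi // mulr0.
under eq_bigr => a _.
  rewrite (sum_codom g_inj) => [|j gj]; last first.
    by rewrite partial_subdet0 ?gj ?orbT // mulr0.
  under eq_bigr do rewrite partial_subdet.
  over.
rewrite mxE; apply: eq_bigr => a _; rewrite mxE big_distrl /=.
apply: eq_bigr => b _; rewrite mul_diag_mx mul_mx_diag !mxE /pi_coef.
by rewrite intrD; ring.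
Qed.

Lemma subrow_codom a X : subrow (f a) X = row a (mxsub f g X).
Proof. by apply/rowP => b; rewrite !mxE. Qed.

Lemma subcol_codom b X : subcol (g b) X = col b (mxsub f g X).
Proof. by apply/colP => a; rewrite !mxE. Qed.

Lemma sgn_diag_codom p (h : 'I_r -> 'I_p) a b : sgn_diag h (h a) a b = 0.
Proof. by rewrite !mxE subrr sgr0 mul0rn. Qed.

(** Outside the image no difference is zero, so every diagonal sign is 1 or -1. *)
Lemma sgn_diag_notin p (h : 'I_r -> 'I_p) (k : 'I_p) :
  k \notin codom h -> sgn_diag h k *m sgn_diag h k = 1%:M.
Proof.
move=> kh; rewrite mulmx_diag -diag_const_mx; congr diag_mx.
apply/rowP => a; rewrite !mxE -intrM -expr2 sqr_sg subr_eq0.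
case: eqP => // -[/val_inj hk].
by move: kh; rewrite -hk codom_f.
Qed.

(** Here W is row [a] of A, so W adj A is d times a unit row, which E kills because its entry at [a]
    is sign(0) = 0. *)
Lemma bracket_subdet_row a l X : let A := mxsub f g X in
  poisson_bracket (mxcoord (f a) l) subdet X =
  (A *m sgn_diag g l *m \adj A *m subcol l X) a 0.
Proof.
move=> A; rewrite bracket_subdet mulmxDr !mulmxA [X in X + _](_ : _ = 0).
  by rewrite add0r subrow_codom -!row_mul mxE.
apply/rowP => b; rewrite subrow_codom -!row_mul mul_mx_adj mul_scalar_mx.
by rewrite mxE [LHS]mxE sgn_diag_codom mulr0 mxE.
Qed.

(** Dually, V is column [b] of A, so adj A V is d times a unit column, killed by D. *)
Lemma bracket_subdet_col k b X : let A := mxsub f g X in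
  poisson_bracket (mxcoord k (g b)) subdet X =
  (subrow k X *m (\adj A *m sgn_diag f k *m A)) 0 b.
Proof.
move=> A; rewrite bracket_subdet -mulmxA mulmxDl mulmxDr !mulmxA.
rewrite [X in _ + X](_ : _ = 0).
  by rewrite addr0 subcol_codom colE mulmxA -colE mxE.
rewrite -!mulmxA [X in _ *m X](_ : _ = 0) ?mulmx0 //.
rewrite subcol_codom colE (mulmxA (\adj _)) mul_adj_mx mul_scalar_mx -scalemxAr.
by apply/colP => a; rewrite -colE !mxE; case: eqVneq => [->|_]; rewrite ?subrr ?mulr0.
Qed.

Lemma bracket_subdet_codom a b X :
  poisson_bracket (mxcoord (f a) (g b)) subdet X = 0.
Proof.
rewrite bracket_subdet_row -mulmxA subcol_codom colE (mulmxA (\adj _)).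
rewrite mul_adj_mx mul_scalar_mx -scalemxAr -mulmxA.
rewrite [X in _ *m X](_ : _ = 0); first by rewrite mulmx0 scaler0 mxE.
by apply/colP => c; rewrite -colE !mxE; case: eqVneq => [->|_]; rewrite ?subrr.
Qed.

End Bracket.

(** * Hyperbolic functions and linear equations *)

Section Derivation.
Variables (R : realType) (f g : R[i] -> R[i]) (t a b : R[i]).
Hypotheses (df : is_derive t 1 f a) (dg : is_derive t 1 g b).

Lemma is_derive_add : is_derive t 1 (fun s => f s + g s) (a + b).
Proof. exact: is_deriveD. Qed.

Lemma is_derive_sub : is_derive t 1 (fun s => f s - g s) (a - b).
Proof. exact: is_deriveB. Qed.

Lemma is_derive_mul : is_derive t 1 (fun s => f s * g s) (f t * b + g t * a).
Proof. exact: is_deriveM. Qed.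

Lemma is_derive_scale (k : R[i]) : is_derive t 1 (fun s => k * f s) (k * a).
Proof. exact: is_deriveZ. Qed.
End Derivation.

Section HyperbolicFunctions.
Variables (R : realType) (d : R[i]).

Definition ccosh (t : R[i]) : R[i] := (cexp (d * t) + cexp (- d * t)) / 2.

(* sinh (d t) / d, extended by its limit t at d = 0. *)
Definition csinhc (t : R[i]) : R[i] :=
  if d == 0 then t else (cexp (d * t) - cexp (- d * t)) / (2 * d).

Lemma cexpVN (z : R[i]) : cexp z * cexp (- z) = 1.
Proof. by rewrite -cexpD subrr cexp0. Qed.

Lemma ccosh0 : ccosh 0 = 1.
Proof. by rewrite /ccosh !mulr0 cexp0 divff // pnatr_eq0. Qed.

Lemma csinhc0 : csinhc 0 = 0.
Proof. by rewrite /csinhc !mulr0 subrr mul0r if_same. Qed.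

Lemma ccosh_sqr_sub t : ccosh t ^+ 2 - d ^+ 2 * csinhc t ^+ 2 = 1.
Proof.
rewrite /ccosh /csinhc; case: eqVneq => [->|d0].
  by rewrite oppr0 !mul0r cexp0; field.
rewrite -[RHS](cexpVN (d * t)) mulNr; field.
by rewrite d0.
Qed.

Lemma is_derive_ccosh (t : R[i]) : is_derive t 1 ccosh (d ^+ 2 * csinhc t).
Proof.
have := is_derive_scale (is_derive_add (is_derive_cexp d t) (is_derive_cexp (- d) t)) 2^-1.
rewrite (_ : (fun _ => _) = ccosh); last by apply/funext => s; rewrite mulrC.
move=> /is_derive_eq; apply; rewrite /csinhc; case: eqVneq => [->|d0].
  by rewrite oppr0 !mul0r addr0 mulr0 expr0n mul0r.
by field; rewrite d0.
Qed.

Lemma is_derive_csinhc (t : R[i]) : is_derive t 1 csinhc (ccosh t).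
Proof.
rewrite /csinhc /ccosh; case: eqVneq => [->|d0].
  rewrite oppr0 !mul0r cexp0 divff ?pnatr_eq0 //.
  exact: is_derive_id.
have := is_derive_scale (is_derive_sub (is_derive_cexp d t) (is_derive_cexp (- d) t)) (2 * d)^-1.
rewrite (_ : (fun _ => _) = (fun s => (cexp (d * s) - cexp (- d * s)) / (2 * d))); last first.
  by apply/funext => s; rewrite mulrC.
by move=> /is_derive_eq; apply; field.
Qed.

(** Applying the inverse of the fundamental matrix, with c = cosh(dt) and s = sinh(dt)/d, gives the
    first integrals c x - s y and c y - d^2 s x. Solving for x uses c^2 - d^2 s^2 = 1. *)
Lemma linear_ode2 (x y : R[i] -> R[i]) :
    (forall t : R[i], is_derive t 1 x (y t)) ->
    (forall t : R[i], is_derive t 1 y (d ^+ 2 * x t)) ->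
  forall t, x t = ccosh t * x 0 + csinhc t * y 0.
Proof.
move=> dx dy t; have dc := is_derive_ccosh; have ds := is_derive_csinhc.
have uE : ccosh t * x t - csinhc t * y t = x 0.
  transitivity (ccosh 0 * x 0 - csinhc 0 * y 0); last first.
    by rewrite ccosh0 csinhc0; ring.
  apply: (@is_derive0_cst _ (fun t => ccosh t * x t - csinhc t * y t)) => s.
  have := is_derive_sub (is_derive_mul (dc s) (dx s)) (is_derive_mul (ds s) (dy s)).
  by move=> /is_derive_eq; apply; ring.
have wE : ccosh t * y t - d ^+ 2 * (csinhc t * x t) = y 0.
  transitivity (ccosh 0 * y 0 - d ^+ 2 * (csinhc 0 * x 0)); last first.
    by rewrite ccosh0 csinhc0; ring.
  apply: (@is_derive0_cst _
    (fun t => ccosh t * y t - d ^+ 2 * (csinhc t * x t))) => s.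
  have := is_derive_sub (is_derive_mul (dc s) (dy s))
     (is_derive_scale (is_derive_mul (ds s) (dx s)) (d ^+ 2)).
  by move=> /is_derive_eq; apply; ring.
by rewrite -uE -wE -[LHS]mul1r -(ccosh_sqr_sub t); ring.
Qed.

(** Each pair of coordinates of v and M v solves the scalar system, since M (M v) = d^2 v. *)
Lemma linear_system_ode (r : nat) (M : 'M[R[i]]_r) (v : R[i] -> 'cV[R[i]]_r) :
    M *m M = (d ^+ 2)%:M ->
    (forall (t : R[i]) a, is_derive t 1 (fun s => v s a 0) ((M *m v t) a 0)) ->
  forall t, v t = ccosh t *: v 0 + csinhc t *: (M *m v 0).
Proof.
move=> MM dv t; apply/colP => a; rewrite 3!mxE.
apply: (linear_ode2 (x := fun s => v s a 0) (y := fun s => (M *m v s) a 0)) => // s.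
have -> : d ^+ 2 * v s a 0 = \sum_b M a b * (M *m v s) b 0.
  by have := congr1 (fun B => (B *m v s) a 0) MM; rewrite mul_scalar_mx -mulmxA !mxE.
rewrite (_ : (fun _ => _) = \sum_b (fun s => M a b * v s b 0)); last first.
  by apply/funext => z; rewrite fct_sumE mxE.
by apply: is_derive_sum => b; apply: is_derive_scale.
Qed.
End HyperbolicFunctions.

(** * Matrix identities for signs conjugated by A and its adjugate *)

Section Conjugates.
Variables (K : comNzRingType) (r : nat) (A D E : 'M[K]_r).
Hypotheses (DD : D *m D = 1%:M) (EE : E *m E = 1%:M).

Lemma mul_mx_adj_mx (B C : 'M[K]_r) : B *m A *m \adj A *m C = \det A *: (B *m C).
Proof. by rewrite -(mulmxA B) mul_mx_adj mul_mx_scalar scalemxAl. Qed.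

Lemma mul_adj_mx_mx (B C : 'M[K]_r) : B *m \adj A *m A *m C = \det A *: (B *m C).
Proof. by rewrite -(mulmxA B) mul_adj_mx mul_mx_scalar scalemxAl. Qed.

Lemma conj_adj_sqr :
  (A *m D *m \adj A) *m (A *m D *m \adj A) = (\det A ^+ 2)%:M.
Proof.
rewrite !mulmxA mul_adj_mx_mx -!scalemxAl -(mulmxA _ D D) DD mulmx1 mul_mx_adj.
by rewrite scale_scalar_mx.
Qed.

Lemma adj_conj_sqr :
  (\adj A *m E *m A) *m (\adj A *m E *m A) = (\det A ^+ 2)%:M.
Proof.
rewrite !mulmxA mul_mx_adj_mx -!scalemxAl -(mulmxA _ E E) EE mulmx1 mul_adj_mx.
by rewrite scale_scalar_mx.
Qed.

(** W G V is the velocity. With N = adj A E A and M = A D adj A, Q is the common value of N G and G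
    M. *)
Local Notation G := (\adj A *m E + D *m \adj A).
Local Notation Q := (\adj A *m E *m A *m D *m \adj A + \det A *: \adj A).

Lemma adj_conj_velocity : \adj A *m E *m A *m G = Q.
Proof.
rewrite mulmxDr !mulmxA mul_mx_adj_mx -(mulmxA _ E E) EE mulmx1.
by rewrite addrC.
Qed.

Lemma velocity_conj_adj : G *m (A *m D *m \adj A) = Q.
Proof.
rewrite mulmxDl !mulmxA mul_adj_mx_mx DD scale_scalar_mx mulr1.
by rewrite mul_scalar_mx.
Qed.

(** This reflects Q = G M and M^2 = d^2: no matrix beyond G and Q arises. *)
Lemma acceleration_conj_adj : Q *m (A *m D *m \adj A) = \det A ^+ 2 *: G.
Proof.
rewrite mulmxDl -!scalemxAl !mulmxA mul_adj_mx_mx -!scalemxAl.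
rewrite -!(mulmxA _ D D) DD mulmx1 -(mulmxA _ A) mul_mx_adj mul_mx_scalar.
by rewrite mul_adj_mx mul_scalar_mx -scalemxAl !scalerA -scalerDr.
Qed.

(** Expanding gives c^2 G + c s (N G + G M) + s^2 N G M between W and V, where N G = G M = Q and N G
    M = Q M = d^2 G. *)
Lemma mulmx_velocity p q (W : 'M[K]_(p, r)) (V : 'M[K]_(r, q)) (c s : K) :
  (c *: W + s *: (W *m (\adj A *m E *m A))) *m G *m
     (c *: V + s *: (A *m D *m \adj A *m V)) =
  (c ^+ 2 + \det A ^+ 2 * s ^+ 2) *: (W *m G *m V) + (c * s *+ 2) *: (W *m Q *m V).
Proof.
have := acceleration_conj_adj; have := velocity_conj_adj; have := adj_conj_velocity.
move: G Q (A *m D *m \adj A) (\adj A *m E *m A) => B C M N NB BM CM.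
rewrite mulmxDl -!scalemxAl -(mulmxA W) NB mulmxDr !mulmxDl -!scalemxAl -!scalemxAr.
rewrite -!(mulmxA W) !(mulmxA _ M V) BM CM -!scalemxAl -!scalemxAr.
by apply/matrixP => i j; rewrite !mxE; ring.
Qed.

End Conjugates.

(** * The flow *)

Lemma det_eq0_small (K : comNzRingType) (r : nat) (A : 'M[K]_r) :
  (r <= 1)%N -> \det A = 0 -> A = 0.
Proof.
case: r A => [|[|//]] A _ A0; apply/matrixP => a b; first by case: a.
by rewrite !ord1 mxE -det_mx11.
Qed.

Section QuasiExponential.
Variables (R : realType) (r : nat).
Implicit Types (x : R[i] -> R[i]).

(** [(size p).-1] is the degree, read as 0 for the zero polynomial; the truncated subtractions are
    exact for [r >= 1]. *)
Definition quasi_exponential x :=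
  exists (p : {poly R[i]}) (N : nat) (p_ : 'I_N -> {poly R[i]})
         (alpha : 'I_N -> R[i]),
    ((size p).-1 <= 2 * r - 1)%N /\
    (forall a : 'I_N, ((size (p_ a)).-1 <= 2 * r - 2)%N /\ alpha a != 0) /\
    (forall t : R[i],
       x t = p.[t] + \sum_(a < N) (p_ a).[t] * cexp (alpha a * t)).

(** Coefficients are listed from degree 0 upwards; [horner_rec] unfolds on explicit lists, which
    leaves identities for [ring]. *)
Lemma quasi_exponential_poly x (s : seq R[i]) :
    ((size s).-1 <= 2 * r - 1)%N -> (forall t, x t = horner_rec s t) ->
  quasi_exponential x.
Proof.
move=> ss xE; exists (Poly s), 0%N, (fun=> 0), (fun=> 0); split.
  by apply: leq_trans ss; rewrite -!subn1 leq_sub2r ?size_Poly.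
split=> [[]//|t]; by rewrite big_ord0 addr0 xE horner_Poly.
Qed.

Lemma quasi_exponential_cexp x (u v w a : R[i]) : a != 0 ->
    (forall t, x t = u + v * cexp (a * t) + w * cexp (- a * t)) ->
  quasi_exponential x.
Proof.
move=> a0 xE; exists u%:P, 2%N, (fun b => (if b == ord0 then v else w)%:P).
exists (fun b => if b == ord0 then a else - a); split.
  by rewrite size_polyC; case: (u == 0).
split=> [b|t]; last first.
  by rewrite !big_ord_recl big_ord0 /= !hornerC addr0 addrA xE.
split; first by rewrite size_polyC; case: (_ == 0).
by case: ifP; rewrite ?oppr_eq0.
Qed.
End QuasiExponential.

Section Flow.
Variables (R : realType) (m n r : nat) (f : 'I_r -> 'I_m) (g : 'I_r -> 'I_n).
Hypotheses (f_inj : injective f) (g_inj : injective g).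
Implicit Types (X : 'M[R[i]]_(m, n)) (k : 'I_m) (l : 'I_n).

Let H X := \det (mxsub f g X).
Local Notation sgf := (@sgn_diag R r m f).
Local Notation sgg := (@sgn_diag R r n g).

Definition velocity X k l : R[i] := poisson_bracket (mxcoord k l) H X.

(** The number b = W Q V, half of the second derivative at time 0 of an entry with both indices
    outside. *)
Definition half_acceleration X k l : R[i] :=
  let A := mxsub f g X in
  (subrow g k X *m (\adj A *m sgf k *m A *m sgg l *m \adj A + \det A *: \adj A)
    *m subcol f l X) 0 0.

(** The last case integrates (c^2 + d^2 s^2) v + 2 c s b, by (c s)' = c^2 + d^2 s^2 and (s^2)' = 2 c
    s. *)
Definition flow X (t : R[i]) : 'M[R[i]]_(m, n) :=
  \matrix_(k, l)
    let c := ccosh (H X) t in let s := csinhc (H X) t in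
    if (k \in codom f) && (l \in codom g) then X k l
    else if (k \in codom f) || (l \in codom g) then c * X k l + s * velocity X k l
    else X k l + c * s * velocity X k l + s ^+ 2 * half_acceleration X k l.

Lemma flow0 X : flow X 0 = X.
Proof.
apply/matrixP => k l; rewrite mxE ccosh0 csinhc0.
by rewrite /=; case: ifP => // _; case: ifP => _; ring.
Qed.

Lemma mxsub_flow X t : mxsub f g (flow X t) = mxsub f g X.
Proof. by apply/matrixP => a b; rewrite !mxE !codom_f. Qed.

Lemma subrow_flow_codom X t a : subrow g (f a) (flow X t) = subrow g (f a) X.
Proof. by rewrite !subrow_codom mxsub_flow. Qed.

Lemma subcol_flow_codom X t b : subcol f (g b) (flow X t) = subcol f (g b) X.
Proof. by rewrite !subcol_codom mxsub_flow. Qed.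

Lemma subcol_flow X t l : l \notin codom g ->
  let A := mxsub f g X in
  subcol f l (flow X t) = ccosh (H X) t *: subcol f l X
    + csinhc (H X) t *: (A *m sgg l *m \adj A *m subcol f l X).
Proof.
move=> lg A; apply/colP => a; rewrite 3!mxE codom_f (negbTE lg) /= 3!mxE.
rewrite /velocity bracket_subdet_row //.
by congr (_ + _); [congr (_ * _)|]; rewrite [RHS]mxE.
Qed.

Lemma subrow_flow X t k : k \notin codom f ->
  let A := mxsub f g X in
  subrow g k (flow X t) = ccosh (H X) t *: subrow g k X
    + csinhc (H X) t *: (subrow g k X *m (\adj A *m sgf k *m A)).
Proof.
move=> kf A; apply/rowP => b; rewrite 3!mxE codom_f (negbTE kf) /= 3!mxE.
rewrite /velocity bracket_subdet_col //.
by congr (_ + _); [congr (_ * _)|]; rewrite [RHS]mxE.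
Qed.

(** A is unchanged by the flow, so only W and V vary in the bracket. The right-hand side is the time
    derivative of the matching case of [flow]. *)
Lemma velocity_flow X t k l :
  let c := ccosh (H X) t in let s := csinhc (H X) t in
  velocity (flow X t) k l =
    if (k \in codom f) && (l \in codom g) then 0
    else if (k \in codom f) || (l \in codom g)
      then c * velocity X k l + s * (H X ^+ 2 * X k l)
    else (c ^+ 2 + H X ^+ 2 * s ^+ 2) * velocity X k l
       + c * s *+ 2 * half_acceleration X k l.
Proof.
move=> c s.
have [/codomP[a ->]|kf] := boolP (k \in codom f);
  have [/codomP[b ->]|lg] := boolP (l \in codom g) => /=.
- exact: bracket_subdet_codom.
- rewrite /velocity !bracket_subdet_row // mxsub_flow subcol_flow //.
  rewrite mulmxDr -!scalemxAr 2!mxE [X in _ + X = _]mxE; congr (_ + _ * _).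
  by rewrite mulmxA conj_adj_sqr ?sgn_diag_notin // mul_scalar_mx 3!mxE.
- rewrite /velocity !bracket_subdet_col // mxsub_flow subrow_flow //.
  rewrite mulmxDl -!scalemxAl 2!mxE [X in _ + X = _]mxE; congr (_ + _ * _).
  by rewrite -mulmxA adj_conj_sqr ?sgn_diag_notin // mul_mx_scalar 3!mxE.
- rewrite /velocity !bracket_subdet // mxsub_flow subrow_flow // subcol_flow //.
  rewrite mulmx_velocity ?sgn_diag_notin //.
  by rewrite mxE [X in X + _ = _]mxE [X in _ + X = _]mxE.
Qed.

Lemma integral_curve_flow X : integral_curve H (flow X).
Proof.
move=> t k l; rewrite -[poisson_bracket _ _ _]/(velocity _ _ _) velocity_flow.
under eq_fun do rewrite mxE /=.
move: (velocity X k l) (half_acceleration X k l) (X k l) (H X) => v w x d.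
have dc := is_derive_ccosh d t; have ds := is_derive_csinhc d t.
have dcst (z : R[i]) : is_derive t 1 (fun=> z) 0 by exact: is_derive_cst.
case: ifP => _; first exact: dcst.
case: ifP => _.
  apply: is_derive_eq (is_derive_add (is_derive_mul dc (dcst x))
    (is_derive_mul ds (dcst v))) _ => /=.
  by ring.
apply: is_derive_eq (is_derive_add (is_derive_add (dcst x)
    (is_derive_mul (is_derive_mul dc ds) (dcst v)))
  (is_derive_mul (is_derive_mul ds ds) (dcst w))) _ => /=.
by ring.
Qed.

(** The system is triangular: A is constant, then the rows I and columns J solve linear equations
    with constant coefficients, and these determine all remaining velocities. *)
Lemma integral_curve_unique (Y : R[i] -> 'M[R[i]]_(m, n)) :
  integral_curve H Y -> forall t, Y t = flow (Y 0) t.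
Proof.
move=> curveY; set X := Y 0; set A := mxsub f g X.
have sub_eq t : mxsub f g (Y t) = A.
  apply/matrixP => a b; rewrite !mxE.
  apply: (is_derive0_cst (f := fun s => Y s (f a) (g b))) => s.
  by apply: is_derive_eq (curveY s _ _) _; exact: bracket_subdet_codom.
have col_eq t l : subcol f l (Y t) = subcol f l (flow X t).
  have [/codomP[b ->]|lg] := boolP (l \in codom g).
    by rewrite subcol_flow_codom !subcol_codom sub_eq.
  rewrite subcol_flow //.
  apply: (linear_system_ode (v := fun s => subcol f l (Y s))).
    by rewrite conj_adj_sqr // sgn_diag_notin.
  move=> s a; under eq_fun do rewrite 2!mxE.
  apply: is_derive_eq (curveY s _ _) _.
  by rewrite (bracket_subdet_row f_inj g_inj) sub_eq.
have row_eq t k : subrow g k (Y t) = subrow g k (flow X t).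
  have [/codomP[a ->]|kf] := boolP (k \in codom f).
    by rewrite subrow_flow_codom !subrow_codom sub_eq.
  (* Transposition turns the row equation W' = W N into a column system. *)
  apply: trmx_inj; rewrite subrow_flow // linearD !linearZ /= trmx_mul.
  apply: (linear_system_ode (v := fun s => (subrow g k (Y s))^T)).
    rewrite -trmx_mul adj_conj_sqr ?sgn_diag_notin //.
    by rewrite tr_scalar_mx.
  move=> s b; under eq_fun do rewrite 3!mxE.
  apply: is_derive_eq (curveY s _ _) _.
  by rewrite (bracket_subdet_col f_inj g_inj) sub_eq -trmx_mul [RHS]mxE.
move=> t; apply/matrixP => k l; apply/eqP; rewrite -subr_eq0.
apply/eqP; transitivity (Y 0 k l - flow X 0 k l); last by rewrite flow0 subrr.
apply: (is_derive0_cst (f := fun s => Y s k l - flow X s k l)) => s.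
apply: is_derive_eq (is_derive_sub (curveY s k l) (integral_curve_flow X s k l)) _.
(* The bracket depends only on A, W and V, which agree on both curves. *)
by rewrite !(bracket_subdet f_inj g_inj) row_eq col_eq sub_eq mxsub_flow subrr.
Qed.

(** This removes the t^2 term when [r = 1], where the degree bound is 1. *)
Lemma half_acceleration_eq0 X k l : (r <= 1)%N -> H X = 0 -> half_acceleration X k l = 0.
Proof.
rewrite /half_acceleration /H => r1 A0.
by rewrite A0 (det_eq0_small r1 A0) scale0r addr0 mulmx0 !mul0mx mulmx0 mul0mx mxE.
Qed.

Lemma quasi_exponential_flow X k l :
  (1 <= r)%N -> quasi_exponential r (fun t => flow X t k l).
Proof.
move=> r1; have acc0 := @half_acceleration_eq0 X k l.
under eq_fun do rewrite mxE /=.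
move: (velocity X k l) (half_acceleration X k l) (X k l) (H X) acc0 => v w x d w0.
case: (_ && _); first by apply: (quasi_exponential_poly (s := [:: x])) => // t /=; ring.
have [d0|d0] := eqVneq d 0.
  have cE t : ccosh d t = 1.
    by rewrite /ccosh d0 oppr0 !mul0r cexp0 divff // pnatr_eq0.
  have sE t : csinhc d t = t by rewrite /csinhc d0 eqxx.
  case: (_ || _).
    apply: (quasi_exponential_poly (s := [:: x; v])) => [/=|t /=]; first by lia.
    by rewrite cE sE; ring.
  have [r_le1|r_gt1] := leqP r 1.
    apply: (quasi_exponential_poly (s := [:: x; v])) => [/=|t /=]; first by lia.
    by rewrite cE sE w0 //; ring.
  apply: (quasi_exponential_poly (s := [:: x; v; w])) => [/=|t /=]; first by lia.
  by rewrite cE sE; ring.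
case: (_ || _).
  (* These are the coefficients of exp(dt) and exp(-dt) in c x + s v. *)
  apply: (quasi_exponential_cexp r (u := 0) (v := (x + v / d) / 2)
    (w := (x - v / d) / 2) d0).
  by move=> t; rewrite /ccosh /csinhc (negbTE d0); field.
(* They come from c s = sinh(2dt)/(2d) and s^2 = (cosh(2dt) - 1)/(2d^2). *)
apply: (quasi_exponential_cexp r (u := x - w / (2 * d ^+ 2))
  (v := (v / d + w / d ^+ 2) / 4) (w := (w / d ^+ 2 - v / d) / 4) (a := d + d)).
  by rewrite -mulr2n mulrn_eq0.
move=> t; rewrite /ccosh /csinhc (negbTE d0).
have -> : cexp ((d + d) * t) = cexp (d * t) ^+ 2 by rewrite mulrDl cexpD.
have -> : cexp (- (d + d) * t) = cexp (- d * t) ^+ 2.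
  by rewrite opprD mulrDl cexpD.
have := cexpVN (d * t); rewrite -mulNr.
move: (cexp (d * t)) (cexp (- d * t)) => e e' ee'.
(* The cross term of s^2 carries [e * e']; writing the constant with this factor makes the identity
   rational in [e] and [e']. *)
have -> : w / (2 * d ^+ 2) = w * (e * e') / (2 * d ^+ 2) by rewrite ee' mulr1.
by field.
Qed.
End Flow.

Theorem theorem2p2 (R : realType) (m n r : nat)
    (hm : (1 <= m)%N) (hn : (1 <= n)%N) (hr : (1 <= r)%N)
    (I : {set 'I_m}) (J : {set 'I_n}) (cardI : #|I| = r) (cardJ : #|J| = r) :
  complete_flow (@minor R m n r I J cardI cardJ) /\
  (forall X : R[i] -> 'M[R[i]]_(m, n),
     integral_curve (@minor R m n r I J cardI cardJ) X ->
     forall (k : 'I_m) (l : 'I_n),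
     exists (p : {poly R[i]}) (N : nat) (p_ : 'I_N -> {poly R[i]})
            (alpha : 'I_N -> R[i]),
       ((size p).-1 <= 2 * r - 1)%N /\
       (forall a : 'I_N, ((size (p_ a)).-1 <= 2 * r - 2)%N /\ alpha a != 0) /\
       (forall t : R[i],
          X t k l = p.[t] + \sum_(a < N) (p_ a).[t] * cexp (alpha a * t))).
have [f f_inj [g g_inj ->]] : exists2 f : 'I_r -> 'I_m, injective f &
    exists2 g : 'I_r -> 'I_n, injective g &
    @minor R m n r I J cardI cardJ = fun X => \det (mxsub f g X).
  exists (fun a => enum_val (cast_ord (esym cardI) a)).
    by move=> a b /enum_val_inj /cast_ord_inj.
  exists (fun b => enum_val (cast_ord (esym cardJ) b)).
    by move=> a b /enum_val_inj /cast_ord_inj.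
  by apply/funext => X; congr (\det _).
split=> [X0|X curveX k l].
  exists (flow f g X0); split; first exact: flow0.
  exact: integral_curve_flow.
(* By uniqueness, an arbitrary integral curve inherits the form of the explicit flow from its
   initial value. *)
have [p [N [p_ [alpha [sp [sp_ pE]]]]]] := quasi_exponential_flow f g (X 0) k l hr.
exists p, N, p_, alpha; split=> //; split=> // t.
by rewrite (integral_curve_unique f_inj g_inj curveX).
Qed.
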